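(* Let $f$ be a positive, strictly decreasing function defined on $\mathbb{N}=\{0,1,2,\dots\}$ such that $f(1)<1$. For each integer $k\ge 1$, let $p_k$ be the probability mass function on $\mathbb{N}$ defined by $p_k(0)=1-f(k)$, $p_k(k)=f(k)$, and $p_k(l)=0$ for all other $l$. Let $\Lambda^1=\{p_1,p_2,\dots\}$, and let $\Lambda$ be the class of stationary memoryless sources on the alphabet $\mathbb{N}$ with first marginal in $\Lambda^1$. The finiteness of the minimax redundancy with respect to $\Lambda^n$ depends on the limiting behavior of $f(k)\log k$: for every positive integer $n$, $$f(k)\log k\to_{k\to\infty}\infty \iff R^+(\Lambda^n)=\infty .$$
   Context: Logarithms are in base 2. A source on a countable alphabet $\mathcal{X}$ is a probability distribution $P$ on $\mathcal{X}^{\mathbb{N}}$; $P^n$ is the law of the first $n$ symbols and $\Lambda^n=\{P^n:P\in\Lambda\}$. A stationary memoryless source is one whose symbols are i.i.d. $\mathfrak{M}_1(\mathcal{X}^n)$ is the set of probability distributions on $\mathcal{X}^n$, and $D(P^n,Q^n)=\sum_{\mathbf{x}\in\mathcal{X}^n}P^n(\mathbf{x})\log\frac{P^n(\mathbf{x})}{Q^n(\mathbf{x})}$ is the Kullback–Leibler divergence. The minimax redundancy is $$R^+(\Lambda^n)=\inf_{Q^n\in\mathfrak{M}_1(\mathcal{X}^n)}\ \sup_{P\in\Lambda}D(P^n,Q^n).$$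
   Formalization: The ''if R⁺=∞ then f(k)log k→∞'' direction fails when f(k)log k is unbounded but has no limit; the formal theorem proves the equivalence when f(k)log k has a limit in the extended reals, and in general that limsup f(k)log k=∞ iff R⁺(Λⁿ)=∞. *)

(* Defs.v *)
From mathcomp Require Import all_boot all_order all_algebra.
From mathcomp Require Import all_classical all_reals all_analysis.
Set Implicit Arguments.
Unset Strict Implicit.
Unset Printing Implicit Defensive.
Import Order.TTheory GRing.Theory Num.Theory.
Import numFieldNormedType.Exports.

Local Open Scope classical_set_scope.
Local Open Scope ring_scope.

Definition log2 (R : realType) (x : R) : R := ln x / ln 2.

Definition coordinate_events : set (set (nat -> nat)) :=
  [set C | exists i (A : set nat), C = [set w | A (w i)]].

Definition sequence_space := g_sigma_algebraType coordinate_events.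

Definition source (R : realType) := probability sequence_space R.

Definition first_symbols n (w : nat -> nat) : n.-tuple nat := [tuple w i | i < n].

Definition first_symbols_law (R : realType) n (P : source R) : n.-tuple nat -> R :=
  fun x => fine (P [set w | first_symbols n w = x]).

Definition symbol_law (R : realType) (P : source R) (i : nat) : nat -> R :=
  fun a => fine (P [set w | w i = a]).

(* Some of the events [A i] may be [setT], so the product rule over initial
   segments covers every finite subfamily of symbols. *)
Definition independent_symbols (R : realType) (P : source R) : Prop :=
  forall n (A : nat -> set nat),
    P [set w | forall i, (i < n)%N -> A i (w i)] =
    (\prod_(i < n) P [set w | A i (w i)])%E.

Definition stationary_memoryless (R : realType) (P : source R) : Prop :=
  (forall i, symbol_law P i = symbol_law P 0) /\ independent_symbols P.

Definition pmf_on (R : realType) (T : choiceType) : set (T -> R) :=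
  [set q | (forall x, 0 <= q x) /\ (\esum_(x in setT) (q x)%:E = 1)%E].

Definition KL_term (R : realType) (p q : R) : \bar R :=
  if p == 0 then 0%E else if q == 0 then +oo%E else (p * log2 (p / q))%:E.

(* [esum] is a supremum over finite subsets, hence only meaningful for
   nonnegative families. For probability mass functions the negative parts of
   the terms are summable, so the difference is never of the form oo - oo. *)
Definition KL (R : realType) (T : choiceType) (p q : T -> R) : \bar R :=
  (\esum_(x in setT) maxe (KL_term (p x) (q x)) 0 -
   \esum_(x in setT) maxe (- KL_term (p x) (q x)) 0)%E.

Definition first_symbols_laws (R : realType) n (L : set (source R)) :
    set (n.-tuple nat -> R) :=
  [set first_symbols_law P | P in L].
Arguments first_symbols_laws {R} n L.

Definition minimax_redundancy (R : realType) (T : choiceType)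
    (Ln : set (T -> R)) : \bar R :=
  ereal_inf [set ereal_sup [set KL p q | p in Ln] | q in @pmf_on R T].

Definition spike_pmf (R : realType) (f : nat -> R) (k : nat) : nat -> R :=
  fun l => if l == 0%N then 1 - f k else if l == k then f k else 0.

Definition spike_marginals (R : realType) (f : nat -> R) : set (nat -> R) :=
  [set spike_pmf f k | k in [set k | (1 <= k)%N]].

Definition memoryless_class (R : realType) (L1 : set (nat -> R)) :
    set (source R) :=
  [set P | stationary_memoryless P /\ L1 (symbol_law P 0)].

(* Main.v *)
From HB Require Import structures.
Require Import Defs.
From mathcomp Require Import all_boot all_order all_algebra.
From mathcomp Require Import all_classical all_reals all_analysis.
From mathcomp Require Import measurable_realfun.
From mathcomp Require Import ring lra.
Import Order.TTheory GRing.Theory Num.Theory.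
Import numFieldNormedType.Exports.
Local Open Scope classical_set_scope.
Local Open Scope ring_scope.
Set Implicit Arguments.
Unset Strict Implicit.

(** Both equivalences reduce to one fact: the redundancy is infinite if and
    only if [f k * log2 k] is unbounded above. An upper limit is [+oo] exactly
    when the sequence is unbounded above, and a convergent sequence tends to
    its upper limit.

    The law of the first [n] symbols of the source with marginal [p_k] lives on
    the words over the letters [0] and [k]. These are indexed by the finite
    type of maps from ['I_n] to [bool], so a divergence from this law is a
    finite sum. The nonzero words have total mass [1 - (1 - f k) ^+ n], which
    lies between [f k] and [n * f k], and nonzero words for different [k] are
    different.

    Unbounded implies infinite. Let [q] be any coding distribution and [k] a
    positive integer. The sets of nonzero words over [{0, j}], for [j] from 1
    to [k], are disjoint, so one of them has [q]-mass at most [1 / k]. Under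
    the source with parameter [j] that set has mass at least [f j >= f k], since
    [f] decreases. A pointwise form of the Donsker-Varadhan inequality
    ([KL_term_ge]) turns this into a divergence of at least
    [f k * log2 k - 1 / ln 2] ([KL_spike_law_ge]).

    Bounded implies finite. Take for [q] the Bayes mixture of the laws with
    prior weight [1 / (j (j + 1))] on the parameter [j]. On nonzero words the
    likelihood ratio is at most [k (k + 1)], which costs at most
    [n * f k * log2 (k (k + 1))]; the zero word costs a constant, because the
    component [j = 1] gives it mass at least [(1 - f 1) ^+ n / 2]
    ([KL_spike_mixture_le]).

    The supremum defining the redundancy ranges over sources, so the lower bound
    also needs the memoryless sources to exist on the space of sequences. They
    are obtained as images of Lebesgue measure on [[0, 1[] under a coding by
    nested intervals ([spike_source_exists]). *)

(** * Memoryless binary sources *)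

(** The digits of [x] in the subdivision of [[l, l + p[] where each interval is
    cut in the proportion [1 - c] to [c], the right part carrying the digit
    [true]. For a uniform point of [[0, 1[] the digits are independent coin
    flips with success probability [c]. *)
Fixpoint coin_flip (R : realType) (c l p x : R) (i : nat) : bool :=
  let m := l + p * (1 - c) in
  if i is i'.+1 then
    if m <= x then coin_flip c m (p * c) x i'
    else coin_flip c l (p * (1 - c)) x i'
  else m <= x.

Lemma measurable_coin_flip (R : realType) (c l p : R) (i : nat) :
  measurable_fun [set: R] (fun x => coin_flip c l p x i).
Proof.
elim: i l p => [|i IH] l p /=; first exact: measurable_fun_ler.
apply: measurable_fun_ifT; [exact: measurable_fun_ler|exact: IH|exact: IH].
Qed.

Lemma measurable_cylinder (R : realType) (c l p : R) (B : nat -> set bool) n :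
  measurable [set x : R | forall i, (i < n)%N -> B i (coin_flip c l p x i)].
Proof.
have -> : [set x : R | forall i, (i < n)%N -> B i (coin_flip c l p x i)] =
    \bigcap_(i in `I_n) ((fun x => coin_flip c l p x i) @^-1` (B i)).
  by [].
apply: bigcap_measurableType => i _; rewrite -[X in measurable X]setTI.
exact: measurable_coin_flip.
Qed.

(** Induction on [n] over all starting intervals: a condition on the first
    digit keeps or discards each half, and what remains is the same statement
    about that half. Only lengths of intervals are ever measured. *)
Lemma lebesgue_cylinder (R : realType) (c : R) (B : nat -> set bool) n
    (l p : R) : 0 < c < 1 -> 0 <= p ->
  lebesgue_measure (`[l, l + p[%classic `&`
    [set x | forall i, (i < n)%N -> B i (coin_flip c l p x i)]) =
  (p * \prod_(i < n) ((1 - c) * \1_(B i) false + c * \1_(B i) true))%:E.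
Proof.
move=> /andP[c0 c1]; elim: n B l p => [|n IH] B l p p0.
  rewrite big_ord0 mulr1 [X in _ `&` X](_ : _ = setT) ?setIT; last first.
    by apply/seteqP; split=> x //= _ i.
  rewrite lebesgue_measure_itv /= lte_fin ltrDl; case: ltP => hp.
    by rewrite -EFinD; congr EFin; ring.
  by congr EFin; apply/eqP; rewrite eq_le p0 hp.
set m := l + p * (1 - c).
pose B' i := B i.+1.
pose C0 := `[l, m[%classic `&`
  [set x | forall i, (i < n)%N -> B' i (coin_flip c l (p * (1 - c)) x i)].
pose C1 := `[m, m + p * c[%classic `&`
  [set x | forall i, (i < n)%N -> B' i (coin_flip c m (p * c) x i)].
pose D0 := if false \in B 0%N then C0 else set0.
pose D1 := if true \in B 0%N then C1 else set0.
have pc0 : 0 <= p * c by rewrite mulr_ge0 // ltW.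
have pc1 : 0 <= p * (1 - c) by rewrite mulr_ge0 // subr_ge0 ltW.
have mpc : m + p * c = l + p by rewrite /m; ring.
have mD0 : measurable D0.
  rewrite /D0; case: ifP => // _; apply: measurableI => //.
  exact: measurable_cylinder.
have mD1 : measurable D1.
  rewrite /D1; case: ifP => // _; apply: measurableI => //.
  exact: measurable_cylinder.
rewrite [X in lebesgue_measure X](_ : _ = D0 `|` D1); last first.
  apply/seteqP; split=> x /=.
    rewrite in_itv /= => -[/andP[lx xlp] Bx].
    have B0 := Bx 0%N isT; have BS i : (i < n)%N -> B i.+1 _ := Bx i.+1.
    rewrite /= -/m in B0 BS.
    case: (leP m x) B0 BS => mx B0 BS; [right|left].
      by rewrite /D1 mem_set //=; split=> //; rewrite /= in_itv /= mx mpc.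
    by rewrite /D0 mem_set //=; split=> //; rewrite /= in_itv /= lx.
  case.
    rewrite /D0; case: ifP => // /set_mem B0 [] /=; rewrite in_itv /=.
    move=> /andP[lx xm] Bx; split.
      by rewrite in_itv /= lx -mpc /= (lt_le_trans xm) // lerDl.
    case=> [|i] /=; rewrite -/m leNgt xm //=.
    exact: Bx.
  rewrite /D1; case: ifP => // /set_mem B0 [] /=; rewrite in_itv /=.
  move=> /andP[mx xm] Bx; split.
    by rewrite in_itv /= -mpc xm andbT (le_trans _ mx) // lerDl.
  by case=> [|i] /=; rewrite -/m mx //=; exact: Bx.
rewrite measureU //; last first.
  apply/seteqP; split=> x //= [].
  rewrite /D0 /D1; case: ifP => // _; case: ifP => // _ [] /=.
  by rewrite in_itv /= => /andP[_ xm] _ [] /=; rewrite in_itv /= leNgt xm.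
have E0 : lebesgue_measure D0 =
    (p * ((1 - c) * \1_(B 0%N) false) *
     \prod_(i < n) ((1 - c) * \1_(B' i) false + c * \1_(B' i) true))%:E.
  rewrite /D0 indicE; case: ifP => _; last by rewrite measure0 !(mulr0, mul0r).
  by rewrite IH // mulr1.
have E1 : lebesgue_measure D1 =
    (p * (c * \1_(B 0%N) true) *
     \prod_(i < n) ((1 - c) * \1_(B' i) false + c * \1_(B' i) true))%:E.
  rewrite /D1 indicE; case: ifP => _; last by rewrite measure0 !(mulr0, mul0r).
  by rewrite IH // mulr1.
rewrite [LHS](_ : _ = lebesgue_measure D0 + lebesgue_measure D1)%E // E0 E1.
rewrite -EFinD big_ord_recl -mulrDl -mulrDr -mulrA; congr (_ * (_ * _))%:E.
Qed.

Definition unit_lebesgue (R : realType) : set (measurableTypeR R) -> \bar R :=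
  mrestr lebesgue_measure (measurable_itv `[0 : R, 1[).

Lemma unit_lebesgue_setT (R : realType) : unit_lebesgue setT = 1%:E :> \bar R.
Proof.
by rewrite /unit_lebesgue /mrestr setTI lebesgue_measure_itv /= lte01 sube0.
Qed.

HB.instance Definition _ (R : realType) :=
  Measure.copy (@unit_lebesgue R)
    (mrestr lebesgue_measure (measurable_itv `[0 : R, 1[)).
HB.instance Definition _ (R : realType) :=
  @Measure_isProbability.Build _ _ R (@unit_lebesgue R) (unit_lebesgue_setT R).

Definition coin_word (R : realType) (c : R) (e : bool -> nat)
    (x : measurableTypeR R) : sequence_space :=
  fun i => e (coin_flip c 0 1 x i).

Lemma measurable_coin_word (R : realType) (c : R) (e : bool -> nat) :
  measurable_fun [set: measurableTypeR R] (coin_word c e).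
Proof.
apply: (@measurability _ _ (measurableTypeR R) sequence_space setT _
  coordinate_events) => //.
move=> _ [_ [i [A ->]]] <-; rewrite setTI.
rewrite [X in measurable X](_ : _ =
  (fun x => coin_flip c 0 1 x i) @^-1` (e @^-1` A)) //.
by rewrite -[X in measurable X]setTI; exact: measurable_coin_flip.
Qed.

HB.instance Definition _ (R : realType) (c : R) (e : bool -> nat) :=
  isMeasurableFun.Build _ _ _ _ (coin_word c e) (measurable_coin_word c e).

Definition coin_source (R : realType) (c : R) (e : bool -> nat) : source R :=
  distribution (@unit_lebesgue R) (coin_word c e).

Lemma coin_source_cylinder (R : realType) (c : R) (e : bool -> nat) n
    (A : nat -> set nat) : 0 < c < 1 ->
  coin_source c e [set w | forall i, (i < n)%N -> A i (w i)] =
  (\prod_(i < n) ((1 - c) * \1_(A i) (e false) + c * \1_(A i) (e true)))%:E.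
Proof.
move=> c01.
have := lebesgue_cylinder (fun i => e @^-1` A i) n 0 c01 ler01.
rewrite add0r mul1r => <-.
by rewrite [LHS](_ : _ = lebesgue_measure ([set x | forall i, (i < n)%N ->
  A i (e (coin_flip c 0 1 x i))] `&` `[0, 1[%classic)) // setIC.
Qed.

Lemma coin_source_symbol (R : realType) (c : R) (e : bool -> nat) i
    (A : set nat) : 0 < c < 1 ->
  coin_source c e [set w | A (w i)] =
  ((1 - c) * \1_A (e false) + c * \1_A (e true))%:E.
Proof.
move=> c01; pose B j := if j == i then A else setT.
rewrite [X in coin_source _ _ X](_ : _ =
  [set w | forall j, (j < i.+1)%N -> B j (w j)]); last first.
  apply/seteqP; split=> w /=.
    by move=> Aw j _; rewrite /B; case: eqP => // ->.
  by move=> /(_ i (ltnSn i)); rewrite /B eqxx.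
rewrite coin_source_cylinder // big_ord_recr /= big1 ?mul1r /B ?eqxx // => j _.
by rewrite ltn_eqF //= indicT /=; ring.
Qed.

Lemma coin_source_memoryless (R : realType) (c : R) (e : bool -> nat) :
  0 < c < 1 -> stationary_memoryless (coin_source c e).
Proof.
move=> c01; split=> [i|n A].
  apply/funext => a; rewrite /symbol_law.
  by rewrite !(coin_source_symbol _ _ [set a]).
rewrite coin_source_cylinder // -prodEFin; apply: eq_bigr => i _.
by rewrite coin_source_symbol.
Qed.

Definition spike_letter (k : nat) (b : bool) : nat := if b then k else 0%N.

Lemma spike_source_exists (R : realType) (f : nat -> R) (k : nat) :
  (0 < k)%N -> 0 < f k < 1 -> exists P : source R,
    stationary_memoryless P /\ symbol_law P 0 = spike_pmf f k.
Proof.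
move=> k0 fk01; exists (coin_source (f k) (spike_letter k)).
split; first exact: coin_source_memoryless.
apply/funext => a; rewrite /symbol_law (coin_source_symbol _ _ [set a]) //=.
rewrite /spike_pmf /spike_letter !indicE !classical_sets.in_set1.
have k0' : (k == 0)%N = false by rewrite -leqn0 leqNgt k0.
rewrite (eq_sym 0%N) (eq_sym k); case: eqP => [->|_].
  by rewrite eq_sym k0' /= mulr1 mulr0 addr0.
by case: eqP => _ /=; rewrite mulr0 add0r ?mulr1 ?mulr0.
Qed.

Lemma first_symbols_law_memoryless (R : realType) (P : source R) n
    (x : n.-tuple nat) : stationary_memoryless P ->
  first_symbols_law P x = \prod_(i < n) symbol_law P 0 (tnth x i).
Proof.
move=> [st ind]; rewrite /first_symbols_law.
have -> : [set w | first_symbols n w = x] =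
    [set w | forall i, (i < n)%N -> [set a | a = nth 0%N x i] (w i)].
  apply/seteqP; split=> w /=.
    by move=> <- i ltin; rewrite (nth_mktuple _ _ (Ordinal ltin)).
  move=> wx; apply: eq_from_tnth => i; rewrite tnth_mktuple (wx i) //.
  by rewrite (tnth_nth 0%N).
rewrite (ind n (fun i => [set a | a = nth 0%N x i])) /=.
rewrite (eq_bigr (fun i : 'I_n => (symbol_law P 0 (tnth x i))%:E)).
  by rewrite prodEFin.
move=> i _; rewrite -(st i) /symbol_law (tnth_nth 0%N) fineK //.
apply: fin_num_measure; apply: sub_sigma_algebra.
by exists i, [set a | a = nth 0%N x i].
Qed.

(** * Words over two letters *)

Definition word (n k : nat) (b : {ffun 'I_n -> bool}) : n.-tuple nat :=
  [tuple spike_letter k (b i) | i < n].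

Definition zero_flips (n : nat) : {ffun 'I_n -> bool} := [ffun=> false].
Arguments zero_flips {n}.

Definition spike_law (R : realType) (f : nat -> R) (n k : nat)
    (x : n.-tuple nat) : R :=
  \prod_(i < n) spike_pmf f k (tnth x i).

Lemma word_inj (n j k : nat) (b c : {ffun 'I_n -> bool}) :
  (0 < j)%N -> (0 < k)%N -> b != zero_flips ->
  word j b = word k c -> j = k /\ b = c.
Proof.
move=> j0 k0 b0 bc.
have E i : spike_letter j (b i) = spike_letter k (c i).
  by have := congr1 (fun x => tnth x i) bc; rewrite !tnth_mktuple.
have bcE : b = c.
  apply/ffunP => i; have := E i; rewrite /spike_letter.
  case: (b i) (c i) => [] [] //= jk; first by move: j0; rewrite jk.
  by move: k0; rewrite -jk.
split=> //; have [i bi] : exists i, b i.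
  apply/existsP; apply: contraNT b0 => /existsPn bF.
  by apply/eqP/ffunP => i; rewrite ffunE; apply/negbTE.
by have := E i; rewrite -bcE /spike_letter bi.
Qed.

Lemma word_injective (n k : nat) : (0 < k)%N -> injective (@word n k).
Proof.
move=> k0 b c bc; have [b0|b0] := eqVneq b zero_flips; last first.
  by case: (word_inj k0 k0 b0 bc).
have [c0|c0] := eqVneq c zero_flips; first by rewrite b0.
by case: (word_inj k0 k0 c0 (esym bc)).
Qed.

Lemma word_zero_flips (n j k : nat) : @word n j zero_flips = word k zero_flips.
Proof. by apply: eq_from_tnth => i; rewrite !tnth_mktuple ffunE. Qed.

Section SpikeLaw.
Context (R : realType) (f : nat -> R) (n k : nat).

Lemma spike_law_word (b : {ffun 'I_n -> bool}) : (0 < k)%N ->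
  spike_law f k (word k b) = \prod_(i < n) (if b i then f k else 1 - f k).
Proof.
move=> k0; apply: eq_bigr => i _; rewrite tnth_mktuple /spike_pmf /spike_letter.
by case: (b i); rewrite ?eqxx //= -leqn0 leqNgt k0.
Qed.

Lemma spike_law_off_words (x : n.-tuple nat) :
  (forall b, x <> word k b) -> spike_law f k x = 0.
Proof.
move=> xw; have [i xi] : exists i, tnth x i != 0%N /\ tnth x i != k.
  apply: contrapT => /forallNP H; apply: (xw [ffun i => tnth x i == k]).
  apply: eq_from_tnth => i; rewrite tnth_mktuple ffunE /spike_letter.
  have := H i; case: (eqVneq (tnth x i) k) => [//|xk].
  by case: (eqVneq (tnth x i) 0%N) => // x0 [].
rewrite /spike_law (bigD1 i) //= /spike_pmf.
by case: xi => /negbTE -> /negbTE ->; rewrite mul0r.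
Qed.

Lemma spike_law_ge0 (x : n.-tuple nat) : 0 <= f k <= 1 -> 0 <= spike_law f k x.
Proof.
move=> /andP[f0 f1]; apply: prodr_ge0 => i _; rewrite /spike_pmf.
by case: eqP => _; [rewrite subr_ge0|case: eqP].
Qed.

Lemma sum_spike_law : (0 < k)%N ->
  \sum_(b : {ffun 'I_n -> bool}) spike_law f k (word k b) = 1.
Proof.
move=> k0; under eq_bigr do rewrite spike_law_word //.
rewrite -(bigA_distr_bigA (fun _ (b : bool) => if b then f k else 1 - f k)).
by rewrite big1 // => i _; rewrite big_bool /=; ring.
Qed.

Lemma spike_law_zero : (0 < k)%N ->
  spike_law f k (@word n k zero_flips) = (1 - f k) ^+ n.
Proof.
move=> k0; rewrite spike_law_word // -[n in RHS]card_ord -prodr_const.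
by apply: eq_bigr => i _; rewrite ffunE.
Qed.

Lemma sum_spike_law_nonzero : (0 < k)%N ->
  \sum_(b : {ffun 'I_n -> bool} | b != zero_flips) spike_law f k (word k b)
  = 1 - (1 - f k) ^+ n.
Proof.
move=> k0; have := sum_spike_law k0.
rewrite (bigD1 zero_flips) //= spike_law_zero //.
by move=> /(canRL (addKr _)) ->; rewrite addrC.
Qed.

End SpikeLaw.

Lemma one_sub_exp_ge (R : realType) (a : R) n : (0 < n)%N -> 0 <= a <= 1 ->
  a <= 1 - (1 - a) ^+ n.
Proof.
move=> n0 /andP[a0 a1]; rewrite lerBrDr addrC -lerBrDr.
by rewrite -[leRHS]expr1 ler_wiXn2l // ?subr_ge0 // gerBl.
Qed.

Lemma one_sub_exp_le (R : realType) (a : R) n : 0 <= a <= 1 ->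
  1 - (1 - a) ^+ n <= n%:R * a.
Proof.
move=> /andP[a0 a1]; elim: n => [|n IH]; first by rewrite expr0 subrr mul0r.
rewrite exprS -natr1 mulrDl mul1r.
have e1 : (1 - a) ^+ n <= 1 by rewrite exprn_ile1 ?subr_ge0 // gerBl.
have : a * (1 - a) ^+ n <= a * 1 by rewrite ler_wpM2l.
lra.
Qed.

(** * Divergence from a finitely supported distribution *)

Lemma esum_finType (R : realType) (I : finType) (A : {pred I})
    (a : I -> \bar R) : (forall i, 0 <= a i)%E ->
  (\esum_(i in [set` A]) a i = \sum_(i in A) a i)%E.
Proof.
move=> a0; rewrite esum_fset // [RHS]bigfs ?index_enum_uniq //.
by move=> i _; rewrite mem_index_enum.
Qed.

Lemma esum_finite_support (R : realType) (I : finType) (T : choiceType)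
    (h : I -> T) (a : T -> \bar R) : injective h ->
  (forall i, 0 <= a (h i))%E -> (forall x, (forall i, x <> h i) -> a x = 0%E) ->
  (\esum_(x in setT) a x = \sum_i a (h i))%E.
Proof.
move=> hi a0 aoff.
rewrite (esumID (range h)) //; last first.
  move=> x _; have [[i <-]//|xh] := pselect (exists i, h i = x).
  by rewrite aoff // => i xhi; apply: xh; exists i.
rewrite [X in (_ + X)%E]esum1 ?adde0; last first.
  move=> x [_ xh]; apply: aoff => i xhi; apply: xh; exists i => //.
rewrite setTI esum_image; last by move=> i j _ _ /hi.
rewrite -(@esum_finType _ _ predT) //.
by congr (esum _ _); apply/seteqP; split=> x.
Qed.

Lemma sum_inj_le_esum (R : realType) (I : finType) (T : choiceType)
    (A : {pred I}) (h : I -> T) (q : T -> R) : {in A &, injective h} ->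
  (forall x, 0 <= q x) ->
  ((\sum_(i in A) q (h i))%:E <= \esum_(x in setT) (q x)%:E)%E.
Proof.
move=> hi q0; have H : (\sum_(i in A) q (h i))%:E =
    (\esum_(x in h @` [set i | i \in A]) (q x)%:E)%E.
  rewrite esum_image; last by move=> i j; rewrite !inE => iA jA /hi; apply.
  by rewrite esum_finType ?sumEFin // => i; rewrite lee_fin.
rewrite H [leRHS](esumID (h @` [set i | i \in A])) ?setTI; last first.
  by move=> x _; rewrite lee_fin.
by rewrite leeDl //; apply: esum_ge0 => x _; rewrite lee_fin.
Qed.

Lemma maxe_sub_maxeN (R : realType) (t : \bar R) :
  (maxe t 0 - maxe (- t) 0 = t)%E.
Proof.
case: (leP 0%E t) => t0.
  by rewrite (max_r (_ : - t <= 0)%E) ?oppe_le0 // sube0.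
by rewrite max_l ?oppe_ge0 ?ltW // sub0e oppeK.
Qed.

Lemma KL_finite_support (R : realType) (I : finType) (T : choiceType)
    (h : I -> T) (p q : T -> R) : injective h ->
  (forall x, (forall i, x <> h i) -> p x = 0) ->
  KL p q = (\sum_i KL_term (p (h i)) (q (h i)))%E.
Proof.
move=> hi poff; rewrite /KL.
have H (x : T) : (forall i, x <> h i) -> KL_term (p x) (q x) = 0%E.
  by move=> /poff; rewrite /KL_term => ->; rewrite eqxx.
rewrite !(@esum_finite_support _ _ _ h) //.
- (* A term is never [-oo], so the sum of the negative parts is finite and the
     difference of the two sums may be taken term by term. *)
  rewrite -fin_num_sumeN; last first.
    move=> i _; rewrite /KL_term; case: ifP => _; first by rewrite oppe0 maxxx.
    case: ifP => _; first by rewrite maxC.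
    by rewrite -EFinN -EFin_max.
  by rewrite -big_split /=; apply: eq_bigr => i _; rewrite maxe_sub_maxeN.
- by move=> i; rewrite le_max lexx orbT.
- by move=> x /H ->; rewrite oppe0 maxxx.
- by move=> i; rewrite le_max lexx orbT.
- by move=> x /H ->; rewrite maxxx.
Qed.

Lemma KL_spike_law (R : realType) (f : nat -> R) (n k : nat)
    (q : n.-tuple nat -> R) : (0 < k)%N ->
  KL (spike_law f k) q =
  (\sum_(b : {ffun 'I_n -> bool})
     KL_term (spike_law f k (word k b)) (q (word k b)))%E.
Proof.
move=> k0; apply: KL_finite_support; first exact: word_injective.
exact: spike_law_off_words.
Qed.

Lemma ln2_gt0 (R : realType) : 0 < ln 2 :> R.
Proof. by rewrite ln_gt0 // ltr1n. Qed.

(** This is [ln t <= t - 1] at [t = c * q / p]. Summed over all points it is the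
    Donsker-Varadhan lower bound for the divergence with test function [ln c],
    where [c] may vary from point to point. *)
Lemma KL_term_ge (R : realType) (c p q : R) : 0 < c -> 0 <= p -> 0 <= q ->
  (((p * ln c + p - c * q) / ln 2)%:E <= KL_term p q)%E.
Proof.
move=> c0 p0 q0; rewrite /KL_term; case: eqP => [->|/eqP pN0].
  rewrite lee_fin mul0r addr0 sub0r ler_pdivrMr ?ln2_gt0 //.
  by rewrite mul0r oppr_le0 mulr_ge0 // ltW.
case: eqP => [_|/eqP qN0]; first by rewrite leey.
have {p0 pN0} p0 : 0 < p by rewrite lt0r pN0.
have {q0 qN0} q0 : 0 < q by rewrite lt0r qN0.
rewrite lee_fin /log2 mulrA ler_wpM2r ?invr_ge0 ?(ltW (ln2_gt0 R)) //.
have h : ln (c * q / p) <= c * q / p - 1.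
  have := @le_ln1Dx R (c * q / p - 1); rewrite addrCA subrr addr0; apply.
  by rewrite ltrBDr addrC subrr divr_gt0 // mulr_gt0.
have E : ln (c * q / p) = ln c - ln (p / q).
  by rewrite -ln_div ?posrE ?divr_gt0 //; congr ln; field; rewrite !gt_eqF.
have := ler_wpM2l (ltW p0) h; rewrite E.
have -> : p * (c * q / p - 1) = c * q - p by field; rewrite gt_eqF.
lra.
Qed.

Lemma KL_term_le (R : realType) (c p q : R) : 0 < c -> 0 <= p ->
  p <= c * q -> (KL_term p q <= (p * log2 c)%:E)%E.
Proof.
move=> c0 p0 pcq; rewrite /KL_term; case: eqP => [->|/eqP pN0].
  by rewrite mul0r.
have {p0 pN0} p0 : 0 < p by rewrite lt0r pN0.
have q0 : 0 < q by rewrite -(pmulr_rgt0 _ c0) (lt_le_trans p0).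
rewrite gt_eqF // lee_fin ler_wpM2l ?(ltW p0) // /log2.
rewrite ler_wpM2r ?invr_ge0 ?(ltW (ln2_gt0 R)) // ler_ln ?posrE ?divr_gt0 //.
by rewrite ler_pdivrMr.
Qed.

(** * Lower bound for every coding distribution *)

(** Pigeonhole: if all [k] sets of nonzero words had [q]-mass above [1 / k],
    their disjoint union would have mass above 1. *)
Lemma pmf_nonzero_words_small (R : realType) (n k : nat)
    (q : n.-tuple nat -> R) : (0 < k)%N -> pmf_on q ->
  exists2 j, (0 < j <= k)%N &
    k%:R * \sum_(b : {ffun 'I_n -> bool} | b != zero_flips) q (word j b) <= 1.
Proof.
move=> k0 [q0 q1].
pose h (u : 'I_k * {ffun 'I_n -> bool}) : n.-tuple nat := word u.1.+1 u.2.
have hi : {in [pred u | u.2 != zero_flips] &, injective h}.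
  move=> [i b] [j c]; rewrite !inE /= => b0 _.
  move=> /(word_inj (ltn0Sn i) (ltn0Sn j) b0)[[ij] ->].
  by congr (_, _); exact: val_inj.
have := sum_inj_le_esum hi q0.
rewrite q1 lee_fin (eq_bigl (fun u => predT u.1 && (u.2 != zero_flips))) //.
rewrite -(pair_big predT (fun b => b != zero_flips)
  (fun (i : 'I_k) b => q (word i.+1 b))) /= => le1.
apply: contrapT => /forall2NP H.
have : 1 < \sum_(i < k) \sum_(b | b != zero_flips) q (word i.+1 b).
  rewrite (_ : 1 = \sum_(i < k) (k%:R^-1 : R)); last first.
    by rewrite sumr_const card_ord -[RHS]mulr_natl mulfV // pnatr_eq0 -lt0n.
  apply: ltr_sum.
    by apply/hasP; exists (Ordinal k0); rewrite ?mem_index_enum.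
  move=> i _; have [|/negP] := H i.+1; first by rewrite ltn_ord.
  by rewrite -ltNge => hi1; rewrite -[X in X < _]mulr1 ltr_pdivrMl // ltr0n.
by rewrite ltNge le1.
Qed.

(** The test function is [ln k] on the nonzero words over [{0, j}], where [j]
    comes from the pigeonhole principle, and 0 on the zero word. The three
    error terms of [KL_term_ge] are the total mass 1 of the law, minus at most 1
    for the nonzero words, minus at most 1 for the zero word; together they
    cost at most [1 / ln 2]. *)
Lemma KL_spike_law_ge (R : realType) (f : nat -> R) (n k : nat)
    (q : n.-tuple nat -> R) : (0 < n)%N -> (0 < k)%N ->
  (forall i, 0 <= f i) -> (forall i j, (0 < i <= j)%N -> f j <= f i <= 1) ->
  pmf_on q ->
  exists2 j, (0 < j)%N &
    ((f k * log2 k%:R - (ln 2)^-1)%:E <= KL (spike_law f j) q)%E.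
Proof.
move=> n0 k0 f0 fmono qpmf.
have [j /andP[j0 jk] qj] := pmf_nonzero_words_small k0 qpmf.
have [q0 q1] := qpmf.
exists j => //; have fj : 0 <= f j <= 1.
  by rewrite f0; have /fmono/andP[] : (0 < j <= j)%N by rewrite j0 /=.
have ln20 := ln2_gt0 R.
pose c (b : {ffun 'I_n -> bool}) : R := if b == zero_flips then 1 else k%:R.
pose p (b : {ffun 'I_n -> bool}) := spike_law f j (word j b).
have c0 b : 0 < c b by rewrite /c; case: ifP => // _; rewrite ltr0n.
rewrite KL_spike_law //; apply: (@le_trans _ _ (\sum_b
   ((p b * ln (c b) + p b - c b * q (word j b)) / ln 2)%:E)%E); last first.
  by apply: lee_sum => b _; apply: KL_term_ge => //; exact: spike_law_ge0.
rewrite sumEFin lee_fin -mulr_suml /log2 mulrA -[X in _ - X]mul1r -mulrBl.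
rewrite ler_wpM2r ?invr_ge0 ?(ltW ln20) //.
rewrite sumrB big_split /= sum_spike_law //.
rewrite (bigD1 zero_flips) //= [X in _ <= _ - X](bigD1 zero_flips) //=.
rewrite /c eqxx ln1 mulr0 add0r mul1r.
rewrite (eq_bigr (fun b => p b * ln k%:R)); last by move=> b /negbTE ->.
rewrite [X in _ <= _ - (_ + X)](eq_bigr (fun b => k%:R * q (word j b))).
  2: by move=> b /negbTE ->.
rewrite -mulr_suml -mulr_sumr sum_spike_law_nonzero //.
have qz : q (word j zero_flips) <= 1.
  have := @sum_inj_le_esum R _ _ (pred1 zero_flips) (@word n j) q.
  rewrite q1 big_pred1_eq lee_fin; apply => //.
  by move=> b b' _ _; exact: word_injective.
have lnk : 0 <= ln k%:R :> R by rewrite ln_ge0 // ler1n.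
have fkj : f k <= 1 - (1 - f j) ^+ n.
  apply: le_trans (one_sub_exp_ge n0 fj).
  by have /fmono/andP[] : (0 < j <= k)%N by rewrite j0.
have := ler_wpM2r lnk fkj.
lra.
Qed.

(** * Marginals of joint distributions *)

Definition marginal (R : realType) (T : choiceType) (r : nat -> T -> R)
    (x : T) : R :=
  fine (\esum_(k in setT) (r k x)%:E).

Lemma esum_exchange (R : realType) (S T : choiceType) (a : S -> T -> \bar R) :
  (forall i j, 0 <= a i j)%E ->
  (\esum_(i in setT) \esum_(j in setT) a i j =
   \esum_(j in setT) \esum_(i in setT) a i j)%E.
Proof.
move=> a0; rewrite !esum_esum //.
rewrite (reindex_esum (setT `*`` (fun=> setT)) _ (fun x => (x.2, x.1))) //.
split=> //=; first by move=> [i1 i2] [j1 j2] /= _ _ [] -> ->.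
by move=> [i1 i2] _ /=; exists (i2, i1).
Qed.

Section Marginal.
Context (R : realType) (T : choiceType) (r : nat -> T -> R).

Lemma marginalE x : (forall k x, 0 <= r k x) ->
  (\esum_(k in setT) \esum_(x in setT) (r k x)%:E = 1)%E ->
  (marginal r x)%:E = (\esum_(k in setT) (r k x)%:E)%E.
Proof.
move=> r0 r1; rewrite /marginal fineK // ge0_fin_numE.
  (* A column sum is finite because the total mass bounds it. *)
  apply: le_lt_trans (ltry 1); rewrite -r1; apply: le_esum => k _.
  by apply: esum_ge; exists [set x]; [split|rewrite fsbig_set1].
by apply: esum_ge0 => k _; rewrite lee_fin.
Qed.

Lemma marginal_pmf : (forall k x, 0 <= r k x) ->
  (\esum_(k in setT) \esum_(x in setT) (r k x)%:E = 1)%E ->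
  pmf_on (marginal r).
Proof.
move=> r0 r1; split=> [x|].
  by rewrite -lee_fin marginalE //; apply: esum_ge0 => k _; rewrite lee_fin.
rewrite (@eq_esum _ _ _ _ (fun x => \esum_(k in setT) (r k x)%:E)%E).
  2: by move=> x _; rewrite marginalE.
by rewrite esum_exchange // => x k; rewrite lee_fin.
Qed.

Lemma le_marginal k x : (forall k x, 0 <= r k x) ->
  (\esum_(k in setT) \esum_(x in setT) (r k x)%:E = 1)%E ->
  r k x <= marginal r x.
Proof.
move=> r0 r1; rewrite -lee_fin marginalE //; apply: esum_ge; exists [set k].
  by split.
by rewrite fsbig_set1.
Qed.

End Marginal.

(** * Upper bound from a Bayes mixture *)

(** The weight of the parameter [k.+1]. It telescopes to total mass 1, and the
    logarithm of its inverse is of order [log2 k], which is the rate that a bound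
    on [f k * log2 k] controls. *)
Definition prior (R : realType) (k : nat) : R := (k.+1%:R * k.+2%:R)^-1.

Lemma prior_gt0 (R : realType) k : 0 < prior R k.
Proof. by rewrite invr_gt0 mulr_gt0. Qed.

Lemma esum_prior (R : realType) : (\esum_(k in setT) (prior R k)%:E = 1)%E.
Proof.
have p0 k : (0 <= (prior R k)%:E)%E by rewrite lee_fin ltW // prior_gt0.
rewrite -nneseries_esumT //; apply/cvg_lim => //.
have E : (fun n => \sum_(0 <= k < n) (prior R k)%:E)%E =
    EFin \o (fun n => 1 - n.+1%:R^-1 : R).
  apply/funext => n /=; rewrite sumEFin; congr EFin.
  elim: n => [|n IH]; first by rewrite big_nil invr1 subrr.
  rewrite big_nat_recr //= IH /prior -(natr1 n.+1).
  by field; rewrite !nat1r natr1 !pnatr_eq0.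
rewrite E; apply: cvg_EFin; first exact: nearW.
rewrite -[X in _ --> X]subr0; apply: cvgB; first exact: cvg_cst.
exact: cvg_harmonic.
Qed.

Lemma log2_prior_le (R : realType) k :
  log2 (prior R k)^-1 <= 2 * log2 k.+1%:R + 1.
Proof.
have ln20 := ln2_gt0 R; have k0 : 0 < k.+1%:R :> R by [].
rewrite /log2 ler_pdivrMr //.
rewrite (_ : _ * ln 2 = ln k.+1%:R + ln k.+1%:R + ln 2); last first.
  by field; rewrite gt_eqF.
rewrite /prior invrK -!lnM ?posrE ?mulr_gt0 //.
rewrite ler_ln ?posrE ?mulr_gt0 // -mulrA ler_wpM2l //.
by rewrite -natrM ler_nat mulSn add2n !ltnS leq_pmulr.
Qed.

Lemma log2_prior_ge0 (R : realType) k : 0 <= log2 (prior R k)^-1.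
Proof.
rewrite /log2 divr_ge0 ?(ltW (ln2_gt0 R)) // ln_ge0 // /prior invrK.
by rewrite -natrM ler1n.
Qed.

Definition spike_joint (R : realType) (f : nat -> R) (n k : nat)
    (x : n.-tuple nat) : R := prior R k * spike_law f k.+1 x.

Lemma spike_joint_ge0 (R : realType) (f : nat -> R) (n k : nat)
    (x : n.-tuple nat) :
  (forall j, (0 < j)%N -> 0 <= f j <= 1) -> 0 <= spike_joint f k x.
Proof.
move=> f01; apply: mulr_ge0; first exact/ltW/prior_gt0.
exact/spike_law_ge0/f01.
Qed.

Lemma esum_spike_joint (R : realType) (f : nat -> R) (n : nat) :
  (forall j, (0 < j)%N -> 0 <= f j <= 1) ->
  (\esum_(k in setT) \esum_(x in [set: n.-tuple nat])
     (spike_joint f k x)%:E = 1)%E.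
Proof.
move=> f01; rewrite -(esum_prior R); apply: eq_esum => k _.
rewrite (@esum_finite_support _ _ _ (@word n k.+1)).
- by rewrite sumEFin -mulr_sumr sum_spike_law // mulr1.
- exact: word_injective.
- by move=> b; rewrite lee_fin spike_joint_ge0.
- by move=> x xw; rewrite /spike_joint spike_law_off_words // mulr0.
Qed.

(** The price of learning the parameter, [log2 (prior R k)^-1], is paid only on
    the nonzero words, which have mass at most [n * f k.+1]. The zero word is
    common to all sources, so a single component of the mixture bounds its
    contribution by a constant. *)
Lemma KL_spike_mixture_le (R : realType) (f : nat -> R) (n : nat) :
  (forall j, (0 < j)%N -> 0 <= f j <= 1) -> f 1%N < 1 ->
  exists C : R, forall k,
    (KL (spike_law f k.+1) (marginal (@spike_joint R f n)) <=
     (n%:R * f k.+1 * log2 (prior R k)^-1 + C)%:E)%E.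
Proof.
move=> f01 f1; have r0 k (x : n.-tuple nat) := spike_joint_ge0 k x f01.
have r1 := esum_spike_joint n f01.
set q := marginal (@spike_joint R f n).
(* The mass that the component with parameter 1 gives to the zero word. *)
pose q0 := prior R 0 * (1 - f 1%N) ^+ n.
have q00 : 0 < q0 by rewrite mulr_gt0 ?prior_gt0 // exprn_gt0 // subr_gt0.
exists `|log2 q0^-1| => k.
have /andP[fk0 fk1] := f01 _ (ltn0Sn k).
have pge0 (b : {ffun 'I_n -> bool}) :=
  spike_law_ge0 (word k.+1 b) (f01 _ (ltn0Sn k)).
rewrite KL_spike_law // (bigD1 zero_flips) //= addrC EFinD; apply: leeD.
- apply: (@le_trans _ _ (\sum_(b : {ffun 'I_n -> bool} | b != zero_flips)
    (spike_law f k.+1 (word k.+1 b) * log2 (prior R k)^-1)%:E)%E).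
    apply: lee_sum => b _; apply: KL_term_le => //.
      by rewrite invr_gt0 prior_gt0.
    rewrite -ler_pdivrMl ?invr_gt0 ?prior_gt0 // invrK.
    exact: le_marginal r1.
  rewrite sumEFin lee_fin -mulr_suml sum_spike_law_nonzero //.
  by rewrite ler_wpM2r ?log2_prior_ge0 // one_sub_exp_le // f01.
- have pz : spike_law f k.+1 (@word n k.+1 zero_flips) <= 1.
    by rewrite spike_law_zero // exprn_ile1 // ?subr_ge0 ?gerBl.
  have qz : q0 <= q (word k.+1 zero_flips).
    rewrite (word_zero_flips n k.+1 1).
    apply: le_trans (le_marginal 0 _ _ r1) => //.
    by rewrite /spike_joint spike_law_zero.
  apply: le_trans (@KL_term_le R q0^-1 _ _ _ _ _) _ => //.
  + by rewrite invr_gt0.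
  + by rewrite -ler_pdivrMl ?invr_gt0 // invrK (le_trans _ qz) // ger_pMr.
  + rewrite lee_fin; apply: le_trans (ler_norm _) _.
    by rewrite normrM (ger0_norm (pge0 _)) ler_piMl.
Qed.

(** * Redundancy of the class *)

Section SpikeClass.
Context (R : realType) (f : nat -> R) (n : nat).

Let laws := first_symbols_laws n (memoryless_class (spike_marginals f)).

Lemma spike_lt1 :
  (forall j k, (j < k)%N -> f k < f j) -> f 1%N < 1 ->
  forall k, (0 < k)%N -> f k < 1.
Proof.
move=> f_decr f1_lt1 [//|[|k]] _ //.
by rewrite (lt_trans _ f1_lt1) // f_decr.
Qed.

Lemma spike_laws : (forall k, (0 < k)%N -> 0 < f k < 1) ->
  laws = [set @spike_law R f n k | k in [set k | (1 <= k)%N]].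
Proof.
move=> f01.
have E P k : stationary_memoryless P -> symbol_law P 0 = spike_pmf f k ->
    first_symbols_law P = @spike_law R f n k.
  move=> Pm Pk; apply/funext => x.
  by rewrite first_symbols_law_memoryless // Pk.
apply/seteqP; split=> p /=.
  by move=> [P [Pm [k k0 Pk]] <-]; exists k; rewrite // (E P k).
move=> [k k0 <-]; have [P [Pm Pk]] := spike_source_exists k0 (f01 k k0).
by exists P; [split=> //; exists k|exact: E].
Qed.

Lemma redundancy_unbounded :
  (forall k, 0 < f k) -> (forall j k, (j < k)%N -> f k < f j) -> f 1%N < 1 ->
  (0 < n)%N -> (forall M : R, exists2 k, (0 < k)%N & M < f k * log2 k%:R) ->
  minimax_redundancy laws = +oo%E.
Proof.
move=> f_gt0 f_decr f1_lt1 n_gt0 unb; have f_lt1 := spike_lt1 f_decr f1_lt1.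
apply/ereal_inf_pinfty => _ [q qpmf <-].
apply/eqyP => M M0.
have [k k0 Mk] := unb (M + (ln 2)^-1).
have fmono i j : (0 < i <= j)%N -> f j <= f i <= 1.
  move=> /andP[i0]; rewrite leq_eqVlt => /predU1P[<-|ij].
    by rewrite lexx ltW // f_lt1.
  by rewrite !ltW ?f_decr ?f_lt1.
have [j j0 KLj] := KL_spike_law_ge n_gt0 k0
  (fun i => ltW (f_gt0 i)) fmono qpmf.
apply: (@le_trans _ _ (KL (spike_law f j) q)).
  by apply: le_trans KLj; rewrite lee_fin lerBrDr ltW.
apply: ereal_sup_ubound; exists (@spike_law R f n j) => //.
by rewrite spike_laws => [|i i0]; [exists j|rewrite f_gt0 f_lt1].
Qed.

Lemma redundancy_bounded (M : R) :
  (forall k, 0 < f k) -> (forall j k, (j < k)%N -> f k < f j) -> f 1%N < 1 ->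
  (forall k, (0 < k)%N -> f k * log2 k%:R <= M) ->
  (minimax_redundancy laws < +oo)%E.
Proof.
move=> f_gt0 f_decr f1_lt1 bnd; have f_lt1 := spike_lt1 f_decr f1_lt1.
have f01 j : (0 < j)%N -> 0 <= f j <= 1 by move=> j0; rewrite !ltW ?f_lt1.
have [C KLC] := KL_spike_mixture_le n f01 f1_lt1.
apply: (@le_lt_trans _ _ (n%:R * (2 * M + 1) + C)%:E); last exact: ltry.
pose q := marginal (@spike_joint R f n).
apply: ge_ereal_inf; exists (ereal_sup [set KL p q | p in laws]).
  exists q => //; apply: marginal_pmf; last exact: esum_spike_joint.
  by move=> k x; exact: spike_joint_ge0.
apply: ge_ereal_sup => _ [p + <-].
rewrite spike_laws => [-[[//|k] _ <-]|i i0]; last by rewrite f_gt0 f_lt1.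
apply: le_trans (KLC k) _; rewrite lee_fin lerD2r -mulrA ler_wpM2l //.
have /andP[fk0 fk1] := f01 k.+1 isT.
apply: le_trans (ler_wpM2l fk0 (log2_prior_le R k)) _.
have := bnd k.+1 isT; lra.
Qed.

End SpikeClass.

Theorem proposition6 (R : realType) (f : nat -> R)
    (f_gt0 : forall k, 0 < f k)
    (f_decr : forall j k, (j < k)%N -> f k < f j)
    (f1_lt1 : f 1%N < 1)
    (n : nat) (n_gt0 : (0 < n)%N) :
  let u : nat -> \bar R := fun k => (f k * log2 (k%:R : R))%:E in
  let Rplus : \bar R :=
    minimax_redundancy
      (first_symbols_laws n (memoryless_class (spike_marginals f))) in
  (cvgn u -> (u @ \oo --> +oo%E <-> Rplus = +oo%E)) /\
  (limn_esup u = +oo%E <-> Rplus = +oo%E).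
Proof.
move=> u Rplus.
have esupP : limn_esup u = +oo%E <-> Rplus = +oo%E.
  split=> [uoo|Roo].
    apply: redundancy_unbounded => // M; apply: contrapT => /forall2NP H.
    have : (limn_esup u <= M%:E)%E.
      rewrite limn_esup_lim; apply: lime_le; first exact: is_cvg_esups.
      exists 1%N => // m /= m1; apply: ge_ereal_sup => _ [k /= mk <-].
      have [|/negP] := H k; first by rewrite (leq_trans m1).
      by rewrite -leNgt lee_fin.
    by rewrite uoo leye_eq.
  apply: contrapT => /eqP uoo.
  have [N [M uM]] : exists N, exists M : R,
      forall k, (N <= k)%N -> (u k <= M%:E)%E.
    apply: contrapT => /forallNP unb; move/eqP: uoo; apply.
    rewrite limn_esup_lim (cvg_lim _ (@cvg_esups_inf _ u)) //.
    apply/ereal_inf_pinfty => _ [N _ <-]; apply/eqyP => M _.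
    apply: contrapT => /negP; rewrite -ltNge => uM; apply: (unb N); exists M.
    move=> k Nk; apply: le_trans (ltW uM); apply: ereal_sup_ubound.
    by exists k.
  (* The finitely many terms before [N] are bounded by their maximum. *)
  pose B := Num.max M (\big[Num.max/0]_(k < N) (f k * log2 k%:R)).
  have : (Rplus < +oo)%E.
    apply: (@redundancy_bounded R f n B) => // k _.
    rewrite le_max; have [Nk|kN] := leqP N k; first by rewrite -lee_fin uM.
    rewrite (le_bigmax _ (fun k : 'I_N => f k * log2 k%:R) (Ordinal kN)).
    by rewrite orbT.
  by rewrite Roo.
split=> // cu; rewrite -esupP is_cvg_limn_esupE //.
split=> [/cvg_lim->//|uoo].
by rewrite -uoo.
Qed.
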